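(* Let $d$ be a positive integer. Every bipartite graph $G$ on $n$ vertices with average degree at most $d$ contains an induced subgraph on at least $(\frac{1}{2}+\delta)n$ vertices, where $\delta=(2^7d^{2})^{-4d}$, all of whose connected components are stars.
   Context: A star is a graph $K_{1,r}$ for some $r\ge 0$ (so a single vertex counts as a star). The average degree of a graph on $n$ vertices with $e$ edges is $2e/n$. *)

(* Defs.v *)
(* MathComp *)
From mathcomp Require Import all_boot all_order all_algebra.

Set Implicit Arguments.
Unset Strict Implicit.
Unset Printing Implicit Defensive.

Import GRing.Theory.

Record sgraph := SGraph {
  vertex :> finType;
  adj : rel vertex;
  adj_sym : symmetric adj;
  adj_irrefl : irreflexive adj
}.

Definition edges (G : sgraph) : {set {set G}} :=
  [set [set p.1; p.2] | p : G * G & adj p.1 p.2].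

Definition bipartite (G : sgraph) : Prop :=
  exists A : {set G}, forall x y : G, adj x y -> (x \in A) != (y \in A).

(* For the graph with no vertices this is 0 / 0 = 0. *)
Definition average_degree (G : sgraph) : rat :=
  ((2 * #|edges G|)%:R / #|G|%:R)%R.

Section Induced.
Variables (G : sgraph) (S : {set G}).

Definition induced_adj : rel {x : G | x \in S} :=
  fun u v => adj (val u) (val v).

Lemma induced_adj_sym : symmetric induced_adj.
Proof. by move=> u v; exact: adj_sym. Qed.

Lemma induced_adj_irrefl : irreflexive induced_adj.
Proof. by move=> u; exact: adj_irrefl. Qed.

Definition induced : sgraph := SGraph induced_adj_sym induced_adj_irrefl.

End Induced.

Definition component (G : sgraph) (x : G) : {set G} :=
  [set y | connect (@adj G) x y].

Definition isomorphic (G H : sgraph) : Prop :=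
  exists2 f : G -> H, bijective f & {mono f : x y / adj x y}.

Section CompleteBipartite.
Variables m n : nat.

Definition Kmn_adj : rel ('I_m + 'I_n)%type :=
  fun u v => match u, v with
             | inl _, inr _ | inr _, inl _ => true
             | _, _ => false
             end.

Lemma Kmn_adj_sym : symmetric Kmn_adj.
Proof. by case=> ? []. Qed.

Lemma Kmn_adj_irrefl : irreflexive Kmn_adj.
Proof. by case. Qed.

Definition complete_bipartite : sgraph := SGraph Kmn_adj_sym Kmn_adj_irrefl.

End CompleteBipartite.

Definition star (G : sgraph) : Prop :=
  exists r : nat, isomorphic G (complete_bipartite 1 r).

Definition all_components_stars (G : sgraph) : Prop :=
  forall x : G, star (induced (component x)).

Definition delta (d : nat) : rat :=
  ((2 ^+ 7 * d%:R ^+ 2) ^- (4 * d))%R.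

(* Main.v *)
(** Let A be the larger side of the bipartition. For C in the other side, delete
    from A the set X of vertices with at least two neighbours in C; what remains
    of A together with C induces a star forest on |A| + |C| - |X| vertices, so it
    suffices to make |C| - |X| large. Take C to be a colour class of a random
    colouring with M colours. A vertex of degree m sees on average at most
    min(M, m^2/M) repeated colours, because it has at most m^2/M monochromatic
    pairs of neighbours. Summed over the scales M = r^i this is O(m) independently
    of the number of scales, so with 4d scales one of them has total cost at most
    3n/8, and the gain at that scale is at least (1/8 - delta) n / M. *)

Require Import Defs.
From mathcomp Require Import all_boot all_order all_algebra.
From mathcomp Require Import ring lra.

Set Implicit Arguments.
Unset Strict Implicit.
Unset Printing Implicit Defensive.

Import Order.TTheory GRing.Theory Num.Theory.

Local Open Scope ring_scope.

(** * Stars and star forests *)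

Lemma star_of_center (G : sgraph) (c : G) :
  (forall x y : G, adj x y = ((x == c) (+) (y == c))) -> star G.
Proof.
move=> adjE; pose L : finType := {x : G | x != c}.
exists #|L|.
pose f (x : G) : complete_bipartite 1 #|L| :=
  if insub x : option L is Some u then inr (enum_rank u) else inl ord0.
pose g (u : complete_bipartite 1 #|L|) : G :=
  if u is inr j then val (enum_val j : L) else c.
exists f.
- exists g.
  + move=> x; rewrite /f; case: insubP => [u _ <- | ] /=.
      by rewrite enum_rankK.
    by rewrite negbK => /eqP.
  + case=> [i | j] /=; rewrite /f.
      by rewrite insubF ?eqxx // (ord1 i).
    by rewrite valK enum_valK.
- move=> x y; rewrite adjE /f.
  by case: insubP => [u /negPf -> _ | /negbNE ->];
     case: insubP => [v /negPf -> _ | /negbNE ->].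
Qed.

(** Vertices in [P] have degree at most one. The centre is therefore [x] itself when [x] is outside
    [P] or isolated, and otherwise the only neighbour of [x]. *)
Lemma star_component (G : sgraph) (P : pred G) (x : G) :
    (forall y z : G, adj y z -> P y != P z) ->
    (forall y z t : G, P y -> adj y z -> adj y t -> z = t) ->
  star (induced (component x)).
Proof.
move=> bip uniqN.
have [c xc leaf] : exists2 c : G, connect (@adj G) x c &
    forall y z : G, adj c y -> adj y z -> z = c.
  case Px: (P x); last first.
    exists x => // y z xy yz.
    have Py : P y by move: (bip _ _ xy); rewrite Px; case: (P y).
    by apply: (uniqN y z x Py yz); rewrite adj_sym.
  case: (pickP (adj x)) => [c xc | noN]; last first.
    by exists x => // y z; rewrite noN.
  exists c; first exact: connect1.
  move=> y z cy yz.
  have nPc : P c = false by move: (bip _ _ xc); rewrite Px; case: (P c).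
  have Py : P y by move: (bip _ _ cy); rewrite nPc; case: (P y).
  by apply: (uniqN y z c Py yz); rewrite adj_sym.
have symG : connect_sym (@adj G) by apply: sym_connect_sym; exact: adj_sym.
have compE y : (y \in component x) = ((y == c) || adj c y).
  rewrite inE (same_connect symG xc); apply/idP/idP; last first.
    by case/predU1P => [-> // | /connect1].
  (* Leaves lead back only to [c], so [c] with its neighbours is closed under adjacency and exhausts
     the component. *)
  have closedc : closed (@adj G) [pred y | (y == c) || adj c y].
    apply: intro_closed => // u v uv /= /predU1P [<-|cu]; rewrite inE; first by rewrite uv orbT.
    by rewrite (leaf u v cu uv) eqxx.
  by move=> /(closed_connect closedc) /=; rewrite !inE eqxx.
have cC : c \in component x by rewrite compE eqxx.
apply: (@star_of_center (induced (component x)) (exist _ c cC)) => u v.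
rewrite -!val_eqE /= /induced_adj.
move: u v => [u uC] [v vC] /=.
move: uC vC; rewrite !compE.
case: (eqVneq u c) => [-> _ | _ /= cu]; case: (eqVneq v c) => [-> _ | nvc /= cv] //=.
- by rewrite adj_irrefl.
- by rewrite adj_sym.
- by apply/negP => /(leaf u v cu)/eqP; rewrite (negPf nvc).
Qed.

Lemma induced_star_forest (G : sgraph) (A S : {set G}) :
    (forall x y : G, adj x y -> (x \in A) != (y \in A)) ->
    {in S & S & S, forall x y z, x \in A -> adj x y -> adj x z -> y = z} ->
  all_components_stars (induced S).
Proof.
move=> bip uniqN x.
apply: (@star_component _ (fun u : induced S => val u \in A)).
  by move=> y z; exact: bip.
move=> [y yS] [z zS] [t tS] /= yA yz yt; apply: val_inj => /=.
exact: (uniqN y z t).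
Qed.

(** * Counting edges and colour collisions *)

(** An edge has exactly one end in [A], so sending a pair [(a, b)] with [a] in [A] to the edge it
    spans is injective. *)
Lemma sum_degree_le_edges (G : sgraph) (A : {set G}) :
    (forall x y : G, adj x y -> (x \in A) != (y \in A)) ->
  (\sum_(a in A) #|[set b | adj a b]| <= #|edges G|)%N.
Proof.
move=> bip.
pose D := [set p : G * G | (p.1 \in A) && adj p.1 p.2].
have -> : (\sum_(a in A) #|[set b | adj a b]| = #|D|)%N.
  rewrite -sum1_card.
  rewrite (eq_bigr (fun a => \sum_(b | adj a b) 1)%N); last first.
    by move=> a _; rewrite -sum1_card; apply: eq_bigl => b; rewrite inE.
  rewrite pair_big_dep /=; apply: eq_bigl => p; by rewrite inE.
have injD : {in D &, injective (fun p : G * G => [set p.1; p.2])}.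
  move=> [a b] [a' b']; rewrite !inE /= => /andP[aA ab] /andP[a'A ab'] /setP E.
  have nbA : b \notin A by move: (bip _ _ ab); rewrite aA.
  have nbA' : b' \notin A by move: (bip _ _ ab'); rewrite a'A.
  have := E a; rewrite !inE eqxx /= => /esym/orP[/eqP aa' | /eqP ab'']; last first.
    by move: nbA'; rewrite -ab'' aA.
  have := E b; rewrite !inE eqxx orbT /= => /esym/orP[/eqP ba' | /eqP bb'].
    by move: nbA; rewrite ba' a'A.
  by rewrite aa' bb'.
rewrite -(card_in_imset injD); apply: subset_leq_card.
apply/subsetP => e /imsetP[p]; rewrite inE => /andP[_ pp] ->.
by apply/imsetP; exists p; rewrite ?inE.
Qed.

(** Recolouring [b] arbitrarily loses nothing: the old colour of [b] can still be read off [b'].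
    This gives an injection [h] into all colourings. *)
Lemma card_ffun_collision (T : finType) (M : nat) (b b' : T) : b != b' ->
  (#|[set f : {ffun T -> 'I_M} | f b == f b']| * M <= #|{ffun T -> 'I_M}|)%N.
Proof.
move=> bb'.
rewrite -[X in (_ * X)%N](card_ord M) -cardsT -cardsX.
pose h (q : {ffun T -> 'I_M} * 'I_M) : {ffun T -> 'I_M} :=
  [ffun x => if x == b then q.2 else q.1 x].
rewrite -(card_in_imset (f := h)); first exact: max_card.
move=> [f c] [g e]; rewrite !inE /= !andbT => /eqP fb /eqP gb /ffunP E.
have := E b; rewrite !ffunE eqxx /= => ->.
congr pair; apply/ffunP => x.
have Ex y : y != b -> f y = g y by move=> /negPf yb; have := E y; rewrite !ffunE yb.
case: (eqVneq x b) => [-> | /Ex //].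
by rewrite fb gb Ex // eq_sym.
Qed.

(** * Deleting vertices with repeated neighbours *)

(** The set X of the overview, with [B] in the role of the chosen class C. *)
Definition repeated (G : sgraph) (A B : {set G}) : {set G} :=
  [set a in A | 1 < #|[set b in B | adj a b]|]%N.

Lemma star_forest_minus_repeated (G : sgraph) (A B : {set G}) :
    (forall x y : G, adj x y -> (x \in A) != (y \in A)) ->
    [disjoint A & B] ->
  exists2 S : {set G}, (#|S| + #|repeated A B| = #|A| + #|B|)%N &
    all_components_stars (induced S).
Proof.
move=> bip dAB; exists ((A :\: repeated A B) :|: B).
  rewrite cardsU disjoint_setI0 ?cards0 ?subn0; last first.
    by apply: disjointWl dAB; exact: subsetDl.
  have XA : repeated A B \subset A by apply/subsetP => a; rewrite inE => /andP[].
  rewrite cardsD (setIidPr XA).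
  by rewrite addnAC subnK // subset_leq_card.
apply: (induced_star_forest bip) => x y z.
have SB u : u \in (A :\: repeated A B) :|: B -> (u \in A) = false -> u \in B.
  by rewrite !inE => /orP[/andP[_ ->] | ].
move=> xS yS zS xA xy xz.
have yB : y \in B by apply: SB => //; move: (bip _ _ xy); rewrite xA; case: (y \in A).
have zB : z \in B by apply: SB => //; move: (bip _ _ xz); rewrite xA; case: (z \in A).
have nxB : x \notin B by rewrite (disjointFr dAB xA).
have : (#|[set b in B | adj x b]| <= 1)%N.
  by move: xS; rewrite !inE xA (negPf nxB) orbF andbT -leqNgt.
by move/card_le1_eqP; apply; rewrite inE ?yB ?zB.
Qed.

(** * Cost summed over geometric scales *)

Lemma sum_min_geometric (R : realFieldType) (r m : R) (T : nat) :
    5%:R <= r -> 0 <= m ->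
  \sum_(i < T) Num.min (r ^+ i) (m ^+ 2 / r ^+ i) <= 3%:R * m.
Proof.
move=> r5; rewrite le_eqVlt => /predU1P[<- | m0].
  rewrite mulr0 big1 // => i _; rewrite expr0n /= mul0r minEle.
  by rewrite lt_geF // exprn_gt0 //; lra.
pose phi i := m * r ^+ i / (r ^+ i + m).
have xpos i : 0 < r ^+ i by apply: exprn_gt0; lra.
(* phi increases from 0 to m, and its increments dominate the summands. *)
have step i : Num.min (r ^+ i) (m ^+ 2 / r ^+ i) <= 3%:R * (phi i.+1 - phi i).
  rewrite /phi (exprS r i); have := xpos i; set x := r ^+ i => x0.
  have rx0 : 0 < r * x by apply: mulr_gt0 => //; lra.
  have -> : m * (r * x) / (r * x + m) - m * x / (x + m) =
      m ^+ 2 * (r - 1) * x / ((r * x + m) * (x + m)).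
    by field; apply/andP; split; apply: lt0r_neq0; apply: addr_gt0.
  have den0 : 0 < (r * x + m) * (x + m) by apply: mulr_gt0; apply: addr_gt0.
  (* In both cases the larger of [x] and [m] replaces the other in the denominator, leaving
     [2r + 2 <= 3(r - 1)], which is [r >= 5]. *)
  have [xm | mx] := lerP x m.
    apply: le_trans (_ : x <= _); first by rewrite ge_min lexx.
    rewrite mulrA ler_pdivlMr //.
    have h1 : (r * x + m) * (x + m) <= (r * m + m) * (m + m).
      apply: ler_pM; [lra | lra | | lra].
      by rewrite lerD2r; apply: ler_wpM2l => //; lra.
    have h2 : (r * m + m) * (m + m) <= 3%:R * (m ^+ 2 * (r - 1)).
      have -> : (r * m + m) * (m + m) = m ^+ 2 * (2%:R * r + 2%:R) by ring.
      by rewrite mulrCA ler_wpM2l ?sqr_ge0 //; lra.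
    have := ler_wpM2l (ltW x0) (le_trans h1 h2).
    by rewrite [in leRHS]mulrC -!mulrA.
  apply: le_trans (_ : m ^+ 2 / x <= _); first by rewrite ge_min lexx orbT.
  rewrite mulrA ler_pdivlMr // mulrAC ler_pdivrMr //.
  have h1 : (r * x + m) * (x + m) <= (r * x + x) * (x + x).
    by apply: ler_pM; lra.
  have h2 : (r * x + x) * (x + x) <= 3%:R * (r - 1) * x * x.
    have -> : (r * x + x) * (x + x) = x ^+ 2 * (2%:R * r + 2%:R) by ring.
    have -> : 3%:R * (r - 1) * x * x = x ^+ 2 * (3%:R * (r - 1)) by ring.
    by rewrite ler_wpM2l ?sqr_ge0 //; lra.
  have := ler_wpM2l (sqr_ge0 m) (le_trans h1 h2).
  by congr (_ <= _); ring.
apply: le_trans (ler_sum _ (fun (i : 'I_T) _ => step i)) _.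
rewrite -mulr_sumr -(big_mkord xpredT (fun i => phi i.+1 - phi i)).
rewrite telescope_sumr //.
have phi0 : 0 <= phi 0%N.
  by rewrite /phi; apply: divr_ge0; [apply: mulr_ge0|apply: addr_ge0];
     rewrite ?ltW // ?xpos.
have phiT : phi T <= m.
  rewrite /phi; have := xpos T => xT.
  rewrite ler_pdivrMr; last by apply: addr_gt0.
  by rewrite mulrDr lerDl -expr2 sqr_ge0.
lra.
Qed.

(** * Random colourings, with expectations written as sums over all colourings *)

Section RandomColouring.

Variables (G : sgraph) (A B : {set G}) (M : nat).
Hypothesis M0 : (0 < M)%N.

Let colouring := {ffun G -> 'I_M}.
Let colour_class (f : colouring) (c : 'I_M) := [set b in B | f b == c].
Let deg (a : G) : rat := #|[set b | adj a b]|%:R.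

Lemma sum_colour_class (f : colouring) : (\sum_c #|colour_class f c| = #|B|)%N.
Proof.
rewrite -[RHS]sum1_card (partition_big f xpredT) //=.
by apply: eq_bigr => c _; rewrite -sum1_card; apply: eq_bigl => b; rewrite inE.
Qed.

(** The bound [M] counts colours. The other counts ordered pairs of distinct neighbours, each
    monochromatic in at most a [1/M] share of the colourings. *)
Lemma sum_repeated_le (a : G) :
  (\sum_(f : colouring) \sum_c (a \in repeated A (colour_class f c)))%:R
    <= #|{: colouring}|%:R * Num.min M%:R (deg a ^+ 2 / M%:R).
Proof.
have Mq : 0 < M%:R :> rat by rewrite ltr0n.
rewrite minr_pMr ?ler0n // le_min; apply/andP; split.
  rewrite -natrM ler_nat.
  apply: leq_trans (_ : \sum_(f : colouring) M <= _)%N; last first.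
    by rewrite sum_nat_const.
  apply: leq_sum => f _; rewrite -[leqRHS]card_ord -sum1_card.
  by apply: leq_sum => c _; exact: leq_b1.
pose N := [set b | adj a b].
pose pairs := [set q in setX N N | q.1 != q.2].
have pairsP : (#|pairs| <= #|N| ^ 2)%N.
  rewrite -mulnn -cardsX; apply: subset_leq_card.
  by apply/subsetP => q; rewrite inE => /andP[].
(* A repeated colour at [a] is witnessed by a monochromatic pair of neighbours. *)
have mono (f : colouring) :
    (\sum_c (a \in repeated A (colour_class f c))
       <= \sum_(q in pairs) (f q.1 == f q.2))%N.
  (* The indicator of a monochromatic pair is split by its common colour, so that both sides compare
     colour by colour. *)
  rewrite [leqRHS](_ : _ = \sum_(q in pairs) \sum_(c : 'I_M)
      ((f q.1 == c) && (f q.2 == c)))%N; last first.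
    apply: eq_bigr => q _; rewrite (bigD1 (f q.1)) //= eqxx /= eq_sym big1 ?addn0 //.
    by move=> c /negPf; rewrite eq_sym => ->.
  rewrite exchange_big /=; apply: leq_sum => c _.
  case: (boolP (_ \in _)) => //; rewrite inE => /andP[_ /card_gt1P[b [b' [bin b'in bb']]]].
  move: bin b'in; rewrite !inE => /andP[/andP[_ fb] ab] /andP[/andP[_ fb'] ab'].
  rewrite (bigD1 (b, b')) /=; last by rewrite !inE /= ab ab'.
  by rewrite fb fb'.
rewrite mulrA ler_pdivlMr // /deg -natrX -!natrM ler_nat.
apply: leq_trans (_ : (\sum_(f : colouring) \sum_(q in pairs) (f q.1 == f q.2)) * M <= _)%N.
  by rewrite leq_mul2r; apply/orP; right; apply: leq_sum => f _; exact: mono.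
rewrite exchange_big big_distrl /=.
apply: leq_trans (_ : \sum_(q in pairs) #|{: colouring}| <= _)%N; last first.
  by rewrite sum_nat_const mulnC leq_mul2l pairsP orbT.
apply: leq_sum => q; rewrite inE => /andP[_ qq].
apply: leq_trans (card_ffun_collision M qq).
rewrite leq_mul2r; apply/orP; right.
rewrite -sum1_card big_mkcond [leqRHS]big_mkcond.
by apply: leq_sum => f _; rewrite inE; case: eqP.
Qed.

(** First moment over pairs of a colouring and a colour: the [M] classes of one colouring partition
    [B], so if every class had a gain below the bound, the total would contradict
    [sum_repeated_le]. *)
Lemma exists_colour_class :
  exists2 C : {set G}, C \subset B &
    #|B|%:R - \sum_(a in A) Num.min M%:R (deg a ^+ 2 / M%:R)
      <= M%:R * (#|C|%:R - #|repeated A C|%:R).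
Proof.
set K := \sum_(a in A) _.
have Mq : 0 < M%:R :> rat by rewrite ltr0n.
pose gain (f : colouring) c : rat :=
  #|colour_class f c|%:R - #|repeated A (colour_class f c)|%:R.
case: (pickP (fun p : colouring * 'I_M => #|B|%:R - K <= M%:R * gain p.1 p.2)).
  move=> [f c] /= h; exists (colour_class f c) => //.
  by apply/subsetP => b; rewrite inE => /andP[].
move=> none; exfalso.
pose N : rat := #|{: colouring}|%:R.
have N0 : 0 < N by rewrite ltr0n; apply/card_gt0P; exists [ffun=> Ordinal M0].
have lower : N * (#|B|%:R - K) <= \sum_f \sum_c gain f c.
  rewrite /gain; under eq_bigr => f _ do rewrite sumrB -natr_sum sum_colour_class.
  rewrite sumrB sumr_const -(mulr_natl #|B|%:R) mulrBr lerD2l lerN2.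
  under eq_bigr => f _ do rewrite -natr_sum.
  rewrite -natr_sum.
  rewrite (_ : (\sum_f \sum_c #|repeated A (colour_class f c)| =
     \sum_(a in A) \sum_f \sum_c (a \in repeated A (colour_class f c)))%N).
    rewrite natr_sum mulr_sumr; apply: ler_sum => a _; exact: sum_repeated_le.
  rewrite [RHS]exchange_big; apply: eq_bigr => f _.
  rewrite [RHS]exchange_big; apply: eq_bigr => c _.
  rewrite -sum1_card [LHS]big_mkcond [RHS]big_mkcond /=; apply: eq_bigr => a _.
  by rewrite inE; case: (a \in A) => //=; case: (_ < _)%N.
have upper : M%:R * (\sum_f \sum_c gain f c) < M%:R * (N * (#|B|%:R - K)).
  rewrite mulr_sumr.
  apply: lt_le_trans (_ : \sum_(f : colouring) \sum_(c : 'I_M) (#|B|%:R - K) <= _).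
    apply: ltr_sum; first by apply/hasP; exists [ffun=> Ordinal M0]; rewrite ?mem_index_enum.
    move=> f _; rewrite mulr_sumr; apply: ltr_sum.
      by apply/hasP; exists (Ordinal M0); rewrite ?mem_index_enum.
    by move=> c _; rewrite ltNge (none (f, c)).
  by rewrite !sumr_const card_ord -[_ *+ #|_|]mulr_natl -[_ *+ M]mulr_natl mulrCA.
by move: upper; rewrite ltr_pM2l // ltNge lower.
Qed.

End RandomColouring.

(** * Choice of the scale and conclusion *)

Lemma exists_le_average (R : realFieldType) (T : nat) (F : 'I_T -> R) (c : R) :
  (0 < T)%N -> \sum_i F i <= T%:R * c -> exists i, F i <= c.
Proof.
move=> T0 le.
case: (pickP (fun i => F i <= c)) => [i hi | none]; first by exists i.
have : \sum_(i < T) c < \sum_i F i.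
  apply: ltr_sum; first by apply/hasP; exists (Ordinal T0); rewrite ?mem_index_enum.
  by move=> i _; rewrite ltNge none.
by rewrite sumr_const card_ord -[_ *+ _]mulr_natl ltNge le.
Qed.

(** Since [i < k], at least one factor [r] survives in the denominator. With [c = 16] and [k = 4d]
    this bounds [delta d] times the number of colours. *)
Lemma expr_ratio_bounds (R : realFieldType) (c r i k : nat) :
    (0 < c)%N -> (c <= r)%N -> (i < k)%N ->
  0 < (r%:R ^+ k : R)^-1 * r%:R ^+ i <= c%:R^-1.
Proof.
rewrite -(ler1n R) -(ler_nat R); move: (c%:R : R) (r%:R : R) => {}c {}r c1 cr ik.
have c0 := lt_le_trans ltr01 c1; have r0 := lt_le_trans c0 cr.
have rp j : 0 < r ^+ j by rewrite exprn_gt0.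
rewrite mulr_gt0 ?invr_gt0 //= -[leRHS]div1r ler_pdivlMr // -mulrA ler_pdivrMl // mulr1.
apply: le_trans (_ : r ^+ i.+1 <= _); first by rewrite exprSr ler_wpM2l // ltW.
by rewrite ler_weXn2l // (le_trans c1).
Qed.

Theorem theorem2p1 (d : nat) (hd : (0 < d)%N) (G : sgraph)
    (hbip : bipartite G) (havg : average_degree G <= d%:R) :
  exists S : {set G},
    (1 / 2 + delta d) * #|G|%:R <= #|S|%:R :> rat
    /\ all_components_stars (induced S).
Proof.
have [n0 | n0] := posnP #|G|.
  exists set0; split; first by rewrite n0 mulr0 ler0n.
  by move=> [x xS]; exfalso; move: xS; rewrite inE.
have [A bip leA] : exists2 A : {set G},
    (forall x y : G, adj x y -> (x \in A) != (y \in A)) & (#|~: A| <= #|A|)%N.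
  case: hbip => A bip; have [le | lt] := leqP #|~: A| #|A|; first by exists A.
  exists (~: A); last by rewrite setCK ltnW.
  by move=> x y /bip; rewrite !inE; case: (x \in A); case: (y \in A).
set n : rat := #|G|%:R.
have nq : 0 < n by rewrite ltr0n.
have cardAB : #|A|%:R + #|~: A|%:R = n by rewrite -natrD cardsC.
have leAq : #|~: A|%:R <= #|A|%:R :> rat by rewrite ler_nat.
pose r := (2 ^ 7 * d ^ 2)%N.
have rq : r%:R = 2 ^+ 7 * d%:R ^+ 2 :> rat by rewrite natrM !natrX.
have r16 : (16 <= r)%N by apply: leq_trans (leq_pmulr _ _); rewrite // expn_gt0 hd.
have r0 : (0 < r)%N by apply: leq_trans r16.
have deltaE : delta d = (r%:R ^+ (4 * d))^-1 by rewrite /delta rq.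
set dl := delta d in deltaE *.
(* With [r] transparent, unification would try to evaluate its powers. *)
clearbody dl r; clear rq.
have deltaM i : (i < 4 * d)%N -> 0 < dl * r%:R ^+ i <= 16%:R^-1.
  by rewrite deltaE => lti; apply: expr_ratio_bounds r16 lti.
have /andP[_ dl16] : 0 < dl <= 16%:R^-1.
  by have := deltaM 0%N; rewrite expr0 mulr1; apply; rewrite muln_gt0.
(* A large [A] is itself a valid choice, being independent. Otherwise its complement has more than
   [(1/2 - dl) n] vertices. *)
have [bigA | smallA] := lerP ((1 / 2 + dl) * n) #|A|%:R.
  exists A; split=> //; apply: (induced_star_forest bip) => x y z _ yA _ xA xy.
  by move: (bip _ _ xy); rewrite xA yA.
pose m (a : G) : rat := #|[set b | adj a b]|%:R.
have sum_m : 2%:R * (\sum_(a in A) m a) <= d%:R * n.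
  move: havg; rewrite /average_degree ler_pdivrMr // => havg.
  apply: le_trans havg; rewrite natrM ler_pM2l // -natr_sum ler_nat.
  exact: sum_degree_le_edges.
pose cost i : rat := \sum_(a in A) Num.min (r ^ i)%:R (m a ^+ 2 / (r ^ i)%:R).
(* The total over all scales is at most [3 d n / 2], which is [4d] times [3n/8]. *)
have [i lei] : exists i : 'I_(4 * d), cost i <= 3%:R / 8%:R * n.
  apply: exists_le_average; first by rewrite muln_gt0.
  rewrite /cost exchange_big /=.
  apply: le_trans (_ : \sum_(a in A) 3%:R * m a <= _).
    apply: ler_sum => a _; under eq_bigr => j _ do rewrite natrX.
    by apply: sum_min_geometric; [rewrite ler_nat (leq_trans _ r16) | rewrite ler0n].
  rewrite -mulr_sumr natrM; lra.
have ri0 : (0 < r ^ i)%N by rewrite expn_gt0 r0.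
have [C CB gain] := exists_colour_class A (~: A) ri0.
have dAC : [disjoint A & C] by rewrite disjoint_sym disjoints_subset.
have [S cardS starS] := star_forest_minus_repeated bip dAC.
exists S; split=> //.
have cardSq : #|S|%:R + #|repeated A C|%:R = #|A|%:R + #|C|%:R :> rat.
  by rewrite -!natrD cardS.
(* This suffices because [A], the larger side, has at least [n/2] vertices. *)
suff : dl * n <= #|C|%:R - #|repeated A C|%:R by lra.
have riq : 0 < (r ^ i)%:R :> rat by rewrite ltr0n.
rewrite -(ler_pM2l riq); apply: le_trans gain.
have /andP[_ small] := deltaM i (ltn_ord i).
have small' : (r ^ i)%:R * (dl * n) <= 16%:R^-1 * n.
  by rewrite mulrA ler_pM2r // mulrC natrX.
have dln : dl * n <= 16%:R^-1 * n by rewrite ler_pM2r.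
(* The gain is at least [(1/2 - dl - 3/8) n], and [1/8 = 1/16 + 1/16] covers both [dl] and [dl]
   times the number of colours. *)
move: lei; rewrite /cost => lei; lra.
Qed.
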